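(* Let $\mathcal{H}$ be a set of graphs such that no graph in $\mathcal{H}$ contains a pair of vertices that are false twins. Then the class of $\mathcal{H}$-free atoms has bounded clique-width if and only if the class of $\mathcal{H}$-free graphs has bounded clique-width.
   Context: Graphs are finite, simple and undirected. A graph is $\mathcal{H}$-free if it contains no graph of $\mathcal{H}$ as an induced subgraph. Two (distinct) vertices of a graph are false twins if they have the same neighbourhood (so they are non-adjacent). A clique $K\subseteq V(G)$ (possibly empty) is a clique cut-set of $G$ if $G\setminus K$ is disconnected; an atom is a graph with no clique cut-set (so atoms are connected). The clique-width $\mathrm{cw}(G)$ is the minimum number of labels needed to construct $G$ using four operations: create a new graph consisting of a single vertex with label $i$; take the disjoint union of two labelled graphs; add an edge between every vertex with label $i$ and every vertex with label $j$ ($i\ne j$); relabel every vertex with label $i$ to have label $j$. A class of graphs has bounded clique-width if there is a constant $c$ with $\mathrm{cw}(G)\le c$ for every $G$ in the class; otherwise its clique-width is unbounded. *)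

(* Defs.v *)
From HB Require Import structures.
From mathcomp Require Import all_boot.
From mathcomp Require Import boolp.
Set Implicit Arguments.
Unset Strict Implicit.
Unset Printing Implicit Defensive.

(* The graph without vertices is allowed. *)
Record sgraph := SGraph {
  vertex :> finType;
  edge : rel vertex;
  edge_sym : symmetric edge;
  edge_irr : irreflexive edge }.

Definition isomorphic (G1 G2 : sgraph) : Prop :=
  exists2 f : G1 -> G2, bijective f & forall x y, edge (f x) (f y) = edge x y.

Section Induced.
Variables (G : sgraph) (S : {set G}).

Definition induced_edge : rel {x : G | x \in S} :=
  fun u v => edge (val u) (val v).

Lemma induced_sym : symmetric induced_edge.
Proof. by move=> u v; exact: edge_sym. Qed.

Lemma induced_irr : irreflexive induced_edge.
Proof. by move=> u; exact: edge_irr. Qed.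

Definition induced := SGraph induced_sym induced_irr.
End Induced.

Definition contains_induced (G F : sgraph) : Prop :=
  exists S : {set G}, isomorphic F (induced S).

Definition free (H : sgraph -> Prop) (G : sgraph) : Prop :=
  forall F, H F -> ~ contains_induced G F.

Definition false_twins (G : sgraph) (x y : G) : Prop :=
  x <> y /\ forall z, edge x z = edge y z.

(* With this convention the empty graph is not disconnected, so the whole
   vertex set of a complete graph is not a clique cut-set. *)
Definition disconnected (G : sgraph) : Prop :=
  exists x y : G, ~~ connect (@edge G) x y.

Definition is_clique (G : sgraph) (K : {set G}) : Prop :=
  {in K &, forall x y, x != y -> edge x y}.

Definition clique_cutset (G : sgraph) (K : {set G}) : Prop :=
  is_clique K /\ disconnected (induced (~: K)).

Definition atom (G : sgraph) : Prop :=
  ~ exists K : {set G}, clique_cutset K.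

Record lgraph (k : nat) := LGraph {
  graph_of :> sgraph;
  lab : graph_of -> 'I_k }.

Section Operations.
Variable k : nat.

Lemma point_sym : symmetric (fun _ _ : unit => false).
Proof. by []. Qed.

Lemma point_irr : irreflexive (fun _ _ : unit => false).
Proof. by []. Qed.

Definition lpoint (i : 'I_k) : lgraph k :=
  @LGraph k (SGraph point_sym point_irr) (fun=> i).

Definition union_edge (G1 G2 : sgraph) : rel (G1 + G2) := fun u v =>
  match u, v with
  | inl x, inl y => edge x y
  | inr x, inr y => edge x y
  | _, _ => false
  end.

Lemma union_sym (G1 G2 : sgraph) : symmetric (@union_edge G1 G2).
Proof. by move=> [x|x] [y|y] //=; exact: edge_sym. Qed.

Lemma union_irr (G1 G2 : sgraph) : irreflexive (@union_edge G1 G2).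
Proof. by move=> [x|x] /=; exact: edge_irr. Qed.

Definition lunion (L1 L2 : lgraph k) : lgraph k :=
  @LGraph k (SGraph (@union_sym L1 L2) (@union_irr L1 L2))
    (fun u => match u with inl x => lab x | inr x => lab x end).

Definition join_edge (i j : 'I_k) (L : lgraph k) : rel L := fun x y =>
  [|| edge x y, (lab x == i) && (lab y == j) | (lab x == j) && (lab y == i)].

Lemma join_sym (i j : 'I_k) (L : lgraph k) : symmetric (@join_edge i j L).
Proof.
move=> x y; rewrite /join_edge edge_sym; congr (_ || _).
by rewrite orbC andbC [in RHS]andbC; congr (_ || _); rewrite andbC.
Qed.

Lemma join_irr (i j : 'I_k) (ij : i != j) (L : lgraph k) :
  irreflexive (@join_edge i j L).
Proof.
move=> x; rewrite /join_edge edge_irr /= [(_ == j) && _]andbC orbb.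
by case: eqP => //= ->; exact: negbTE.
Qed.

Definition ljoin (i j : 'I_k) (ij : i != j) (L : lgraph k) : lgraph k :=
  @LGraph k (SGraph (@join_sym i j L) (join_irr ij (L := L))) (@lab k L).

Definition lrelabel (i j : 'I_k) (L : lgraph k) : lgraph k :=
  @LGraph k L (fun x => if lab x == i then j else lab x).

Inductive constructed : lgraph k -> Prop :=
| constructed_point i : constructed (lpoint i)
| constructed_union L1 L2 :
    constructed L1 -> constructed L2 -> constructed (lunion L1 L2)
| constructed_join i j (ij : i != j) L :
    constructed L -> constructed (ljoin ij L)
| constructed_relabel i j L :
    constructed L -> constructed (lrelabel i j L).
End Operations.

(* The four operations only produce nonempty graphs; the first disjunct gives
   the empty graph clique-width 0. *)
Definition constructible (k : nat) (G : sgraph) : Prop :=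
  #|G| = 0 \/ exists2 L : lgraph k, constructed L & isomorphic L G.

Lemma constructed_edgeless k (i : 'I_k) (s : seq 'I_k) : uniq (i :: s) ->
  exists L : lgraph k, [/\ constructed L, injective (@lab k L),
    forall x y : L, edge x y = false
    & forall j, j \in i :: s -> exists x : L, lab x = j] /\
    forall x : L, lab x \in i :: s.
Proof.
elim: s i => [|j s IH] i.
  move=> _; exists (lpoint i); split; last by move=> x; exact: mem_head.
  split=> //; [exact: constructed_point | by move=> [] [] |].
  by move=> j; rewrite inE => /eqP->; exists tt.
rewrite cons_uniq => /andP[ijs /IH[L [[cL injL eL surjL] sL]]].
exists (lunion (lpoint i) L); split; last first.
  by move=> [x|x] /=; [exact: mem_head | rewrite inE sL orbT].
split.
- by apply: constructed_union => //; exact: constructed_point.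
- move=> [[]|x] [[]|y].
  + by [].
  + by move=> /= E; move: ijs; rewrite E sL.
  + by move=> /= E; move: ijs; rewrite -E sL.
  + by move=> /= /injL->.
- by move=> [x|x] [y|y] //=; exact: eL.
- move=> l; rewrite inE => /orP[/eqP->|/surjL[x <-]]; first by exists (inl tt).
  by exists (inr x).
Qed.

Lemma constructible_card (G : sgraph) : constructible #|G| G.
Proof.
have [G0|nG] := eqVneq #|G| 0; first by left.
right; pose n := #|G|.
have edges (E : seq ('I_n * 'I_n)) : all (fun p => p.1 != p.2) E ->
  exists L : lgraph n, [/\ constructed L, bijective (@lab n L)
    & forall x y : L, edge x y = ((lab x, lab y) \in E) || ((lab y, lab x) \in E)].
  elim: E => [_|[i j] E IH /= /andP[ij /IH[L [cL bL eL]]]].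
    have : uniq (enum 'I_n) by exact: enum_uniq.
    have : forall i, i \in enum 'I_n by move=> i; rewrite mem_enum.
    case def: (enum 'I_n) => [|i s] ins.
      have := size_enum_ord n; rewrite def /= => n0.
      by rewrite -/n -n0 in nG.
    move/constructed_edgeless=> [L [[cL injL eL surjL] _]].
    exists L; split=> //.
    have surj j : exists x : L, lab x == j.
      by have [x <-] := surjL _ (ins j); exists x.
    exists (fun j => xchoose (surj j)) => x; last exact/eqP/(xchooseP (surj x)).
    by apply: injL; exact/eqP/(xchooseP (surj (lab x))).
  exists (ljoin ij L); split=> //; first exact: constructed_join.
  move=> x y /=; rewrite /join_edge eL !inE !xpair_eqE.
  rewrite [(lab y == i) && _]andbC.
  case: (_ \in E); rewrite ?orbT //.
  case: (_ \in E); rewrite ?orbT //.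
  by rewrite !orbF.
pose E := [seq p <- enum {: 'I_n * 'I_n} |
  edge (enum_val p.1 : G) (enum_val p.2)].
have [|L [cL bL eL]] := edges E.
  apply/allP=> -[i j]; rewrite mem_filter /= => /andP[+ _].
  by case: eqP => // ->; rewrite edge_irr.
exists L => //; exists (fun x => enum_val (lab x)).
  exact: (bij_comp (@enum_val_bij G) bL).
have edgeE i j : ((i, j) \in E) = edge (enum_val i : G) (enum_val j).
  by rewrite /E mem_filter mem_enum andbT.
by move=> x y; rewrite eL !edgeE [X in _ || X]edge_sym orbb.
Qed.

Lemma constructible_ex (G : sgraph) : exists k, `[< constructible k G >].
Proof. by exists #|G|; apply/asboolP; exact: constructible_card. Qed.

Definition cw (G : sgraph) : nat := ex_minn (constructible_ex G).

Definition bounded_cw (C : sgraph -> Prop) : Prop :=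
  exists c : nat, forall G, C G -> cw G <= c.

(* Main.v *)
Require Import Defs.
From mathcomp Require Import all_boot.
From mathcomp Require Import boolp.
Set Implicit Arguments.
Unset Strict Implicit.
Unset Printing Implicit Defensive.

(** Doubling every vertex of a graph [G] into two false twins yields a graph
    that is still H-free, as no member of H can use both copies of a vertex.
    If [G] is connected with at least two vertices, the doubled graph is an
    atom: a clique misses one copy of every vertex, so a full copy of [G]
    survives its removal.  Since clique-width does not increase when passing to
    an induced subgraph, [G] inherits the bound for atoms; disconnected graphs
    reduce to their components. *)

(** Same relation as [contains_induced], but it composes directly, with no nested subset types. *)
Definition embeds (F G : sgraph) : Prop :=
  exists2 f : F -> G, injective f & forall x y, edge (f x) (f y) = edge x y.

Lemma embeds_trans (F G K : sgraph) : embeds F G -> embeds G K -> embeds F K.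
Proof.
move=> [f injf ef] [g injg eg]; exists (g \o f); first exact: inj_comp.
by move=> x y; rewrite /= eg ef.
Qed.

Lemma induced_embeds (G : sgraph) (S : {set G}) : embeds (induced S) G.
Proof. by exists val => //; exact: val_inj. Qed.

Lemma contains_inducedP (G F : sgraph) : contains_induced G F <-> embeds F G.
Proof.
split=> [[S [f bijf ef]]|[f injf ef]].
  apply: (embeds_trans _ (induced_embeds S)).
  by exists f => //; exact: bij_inj.
pose S := [set f x | x : F].
have fS x : f x \in S by exact: imset_f.
exists S, (fun x => Sub (f x) (fS x) : induced S) => [|x y]; last exact: ef.
have ex (u : induced S) : exists x, f x = val u.
  by have /imsetP[x _ ->] := valP u; exists x.
have [g gK] := fin_all_exists ex.
exists g => [x|u]; first by apply: injf; rewrite gK.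
by apply: val_inj; exact: gK.
Qed.

Lemma free_embeds (H : sgraph -> Prop) (F G : sgraph) :
  embeds F G -> free H G -> free H F.
Proof.
move=> FG Gfree K HK /contains_inducedP KF; apply: (Gfree K HK).
by apply/contains_inducedP; exact: embeds_trans KF FG.
Qed.

(** Induction on the construction: each operation on [L] restricts to the part over [S]. No
    construction yields the empty graph, hence [S != set0]. The map [phi] enlarges the label set in
    the same induction; its injectivity makes joins and relabellings act on the same vertices as
    before. *)
Lemma constructed_sub (k l : nat) (phi : 'I_k -> 'I_l) (L : lgraph k)
    (S : {set L}) :
  injective phi -> constructed L -> S != set0 ->
  exists L' : lgraph l, constructed L' /\ exists g : L' -> L,
    [/\ injective g, forall y, y \in S <-> exists x, g x = y,
        forall x y, edge (g x) (g y) = edge x y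
      & forall x, lab x = phi (lab (g x))].
Proof.
move=> injphi cL; elim: cL S => {L}
  [i|L1 L2 _ IH1 _ IH2|i j ij L _ IH|i j L _ IH] S S0.
- exists (lpoint (phi i)); split; first exact: constructed_point.
  exists id; split=> // -[]; split=> [_|_]; first by exists tt.
  by have /set0Pn[[]] := S0.
- pose S1 := [set x | (inl x : lunion L1 L2) \in S].
  pose S2 := [set x | (inr x : lunion L1 L2) \in S].
  (* If [S] meets only one side of the union, the union step is dropped. *)
  have [S10|/IH1[L1' [c1 [g1 [inj1 im1 e1 l1]]]]] := eqVneq S1 set0;
    have [S20|/IH2[L2' [c2 [g2 [inj2 im2 e2 l2]]]]] := eqVneq S2 set0.
  + have /set0Pn[[x|x] xS] := S0.
      by have := in_set0 x; rewrite -S10 inE xS.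
    by have := in_set0 x; rewrite -S20 inE xS.
  + exists L2'; split=> //; exists (fun x => inr (g2 x)); split=> //.
      by move=> x y [] /inj2.
    move=> [y|y]; split.
    * by move=> yS; have := in_set0 y; rewrite -S10 inE yS.
    * by case.
    * move=> yS; have : y \in S2 by rewrite inE.
      by move/im2=> [x <-]; exists x.
    * by move=> [x [<-]]; have /im2 : exists z, g2 z = g2 x by [exists x];
        rewrite inE.
  + exists L1'; split=> //; exists (fun x => inl (g1 x)); split=> //.
      by move=> x y [] /inj1.
    move=> [y|y]; split.
    * move=> yS; have : y \in S1 by rewrite inE.
      by move/im1=> [x <-]; exists x.
    * by move=> [x [<-]]; have /im1 : exists z, g1 z = g1 x by [exists x];
        rewrite inE.
    * by move=> yS; have := in_set0 y; rewrite -S20 inE yS.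
    * by case.
  + exists (lunion L1' L2'); split; first exact: constructed_union.
    exists (fun u => match u with inl x => inl (g1 x) | inr x => inr (g2 x) end).
    split.
    * by move=> [x|x] [y|y] // [] => [/inj1|/inj2] ->.
    * move=> [y|y]; split.
      - move=> yS; have : y \in S1 by rewrite inE.
        by move/im1=> [x <-]; exists (inl x).
      - move=> [[x|x] // [<-]].
        by have /im1 : exists z, g1 z = g1 x by [exists x]; rewrite inE.
      - move=> yS; have : y \in S2 by rewrite inE.
        by move/im2=> [x <-]; exists (inr x).
      - move=> [[x|x] // [<-]].
        by have /im2 : exists z, g2 z = g2 x by [exists x]; rewrite inE.
    * by move=> [x|x] [y|y] //=.
    * by move=> [x|x] /=.
- have [L' [c [g [injg im e l']]]] := IH S S0.
  have phiij : phi i != phi j by rewrite (inj_eq injphi).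
  exists (ljoin phiij L'); split; first exact: constructed_join.
  exists g; split=> // x y.
  by rewrite /= /join_edge e !l' !(inj_eq injphi).
- have [L' [c [g [injg im e l']]]] := IH S S0.
  exists (lrelabel (phi i) (phi j) L'); split; first exact: constructed_relabel.
  exists g; split=> // x /=.
  by rewrite l' (inj_eq injphi); case: ifP.
Qed.

Lemma constructible_embeds (k l : nat) (F G : sgraph) :
  k <= l -> embeds F G -> constructible k G -> constructible l F.
Proof.
move=> kl [f injf ef] cG.
have [F0|F0] := eqVneq #|F| 0; first by left.
have [x0 _] : exists x : F, x \in F by apply/card_gt0P; rewrite lt0n.
case: cG => [G0|[L cL [h [h' hK h'K] eh]]].
  by have := fintype0 (f x0) G0.
(* [S] is the copy of [F] inside the constructed graph. *)
right; pose S : {set L} := [set h' (f x) | x : F].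
have S0 : S != set0 by apply/set0Pn; exists (h' (f x0)); exact: imset_f.
have widen_inj : injective (widen_ord kl) by move=> i j [] /val_inj.
have [L' [cL' [g [injg im eg _]]]] := constructed_sub widen_inj cL S0.
exists L' => //.
(* Both [g] and [h' \o f] are injective with image [S]; matching their values gives the
   isomorphism. *)
have ex1 (u : L') : exists x, f x = h (g u).
  have /imsetP[x _ ->] : g u \in S by apply/im; exists u.
  by exists x; rewrite h'K.
have ex2 (x : F) : exists u, g u = h' (f x) by apply/im; exact: imset_f.
have [p pE] := fin_all_exists ex1; have [q qE] := fin_all_exists ex2.
exists p; last by move=> u v; rewrite -ef !pE eh eg.
exists q => [u|x]; first by apply: injg; rewrite qE pE hK.
by apply: injf; rewrite pE qE h'K.
Qed.

Lemma embeds_refl (G : sgraph) : embeds G G.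
Proof. by exists id. Qed.

Lemma constructible_cw (G : sgraph) : constructible (cw G) G.
Proof. by rewrite /cw; case: ex_minnP => m /asboolP. Qed.

Lemma cw_leP (G : sgraph) (k : nat) : cw G <= k <-> constructible k G.
Proof.
split=> [le|cG].
  exact: constructible_embeds le (embeds_refl G) (constructible_cw G).
by rewrite /cw; case: ex_minnP => m _; apply; exact/asboolP.
Qed.

(** Nothing is joined after the disjoint union, so both sides can use the same [k] labels. *)
Lemma constructible_split (k : nat) (G : sgraph) (A : {set G}) :
  {in A & ~: A, forall x y, ~~ edge x y} ->
  constructible k (induced A) -> constructible k (induced (~: A)) ->
  constructible k G.
Proof.
move=> sep.
case=> [A0|[L1 c1 [h1 [h1' h1K h1'K] e1]]].
  (* An empty side has no construction, but then [G] embeds in the other side. *)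
  move=> cA; apply: (constructible_embeds (leqnn k) _ cA).
  have nA x : x \in ~: A.
    by rewrite inE; apply/negP=> xA; have := fintype0 (Sub x xA : induced A) A0.
  by exists (fun x => Sub x (nA x) : induced (~: A)) => // x y [].
case=> [A0|[L2 c2 [h2 [h2' h2K h2'K] e2]]].
  have nA x : x \in A.
    apply/negPn/negP=> xA; have xC : x \in ~: A by rewrite inE.
    by have := fintype0 (Sub x xC : induced (~: A)) A0.
  have cA : constructible k (induced A) by
    right; exists L1 => //; exists h1 => //; exists h1'.
  apply: (constructible_embeds (leqnn k) _ cA).
  by exists (fun x => Sub x (nA x) : induced A) => // x y [].
right; exists (lunion L1 L2); first exact: constructed_union.
pose h (u : lunion L1 L2) : G :=
  match u with inl x => val (h1 x) | inr x => val (h2 x) end.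
have hA x : val (h1 x) \in A by exact: valP.
have hC x : val (h2 x) \in ~: A by exact: valP.
exists h; last first.
  move=> [x|x] [y|y]; [exact: e1 | | | exact: e2].
    by apply/negbTE/sep; [exact: hA | exact: hC].
  by rewrite edge_sym; apply/negbTE/sep; [exact: hA | exact: hC].
have injh : injective h.
  have disj x y : val (h1 x) <> val (h2 y).
    by move=> E; have := hC y; rewrite inE -E hA.
  move=> [x|x] [y|y] E.
  - by congr inl; apply: (can_inj h1K); exact: val_inj.
  - by have := disj x y E.
  - by have := disj y x (esym E).
  - by congr inr; apply: (can_inj h2K); exact: val_inj.
have surjh y : exists u, h u = y.
  have [yA|yA] := boolP (y \in A).
    by exists (inl (h1' (Sub y yA))); rewrite /= h1'K.
  have yC : y \in ~: A by rewrite inE.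
  by exists (inr (h2' (Sub y yC))); rewrite /= h2'K.
have [h' hK] := fin_all_exists surjh.
by exists h' => [u|y //]; apply: injh; rewrite hK.
Qed.

Section Doubling.
Variable G : sgraph.

Definition doubled_edge : rel (G * bool) := fun u v => edge u.1 v.1.

Lemma doubled_sym : symmetric doubled_edge.
Proof. by move=> u v; exact: edge_sym. Qed.

Lemma doubled_irr : irreflexive doubled_edge.
Proof. by move=> u; exact: edge_irr. Qed.

Definition doubled := SGraph doubled_sym doubled_irr.

Lemma embeds_doubled : embeds G doubled.
Proof. by exists (fun x => (x, true)) => // x y []. Qed.

(** Adjacency in [doubled] depends on first components only, so two vertices of [F] sent to copies
    of the same vertex would be false twins. Hence projecting to [G] stays injective. *)
Lemma embeds_doubled_twin_free (F : sgraph) :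
  ~ (exists x y : F, false_twins x y) -> embeds F doubled -> embeds F G.
Proof.
move=> notwin [f injf ef]; exists (fun x => (f x).1) => [x y E|]; last exact: ef.
apply: contrapT => xy; apply: notwin; exists x, y; split=> // z.
by rewrite -!ef /= /doubled_edge E.
Qed.

Lemma free_doubled (H : sgraph -> Prop) :
  (forall F, H F -> ~ exists x y : F, false_twins x y) ->
  free H G -> free H doubled.
Proof.
move=> noH Gfree F HF /contains_inducedP FD; apply: (Gfree F HF).
by apply/contains_inducedP; apply: embeds_doubled_twin_free (noH F HF) FD.
Qed.

(** A single vertex must be excluded: its doubling is two isolated vertices, cut by the empty
    clique. *)
Lemma atom_doubled :
  1 < #|G| -> (forall x y : G, connect (@edge G) x y) -> atom doubled.
Proof.
move=> G1 conn [K [cliqueK [u [v /negP]]]]; apply.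
have ex x : exists b, ((x, b) : doubled) \in ~: K.
  have [xK|xK] := boolP (((x, true) : doubled) \in K); last first.
    by exists true; rewrite inE.
  exists false; rewrite inE; apply/negP=> xK'.
  have ne : ((x, true) : doubled) != (x, false) by apply/eqP; case.
  by have := cliqueK _ _ xK xK' ne; rewrite /= /doubled_edge edge_irr.
have [s sK] := fin_all_exists ex.
(* [t] lifts [G] to the surviving copy, and paths of [G] lift along it. *)
pose t x : induced (~: K) := Sub (x, s x) (sK x).
have conn_t x y : connect (@edge (induced (~: K))) (t x) (t y).
  have /connectP[p] := conn x y.
  elim: p x => [x _ -> // | z p IH x /= /andP[xz pz] yE].
  exact: connect_trans (connect1 (xz : edge (t x) (t z))) (IH z pz yE).
(* The first edge of a path from [x] to another vertex. *)
have nbr x : exists z : G, edge x z.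
  have [y yx] : exists y : G, y != x.
    have /card_gt1P[a [b [_ _ ab]]] := G1.
    have [ax|ax] := eqVneq a x; last by exists a.
    by exists b; rewrite -ax eq_sym.
  have /connectP[[|z p]] := conn x y; first by move=> _ E; rewrite E eqxx in yx.
  by move=> /= /andP[xz _] _; exists z.
(* [u] and [v] may lie outside the image of [t], but each has a neighbour in it. *)
have [z uz] := nbr (val u).1; have [w vw] := nbr (val v).1.
have wv : edge (t w) v by rewrite edge_sym.
apply: connect_trans (connect1 (uz : edge u (t z))) _.
exact: connect_trans (conn_t z w) (connect1 wv).
Qed.

End Doubling.

Theorem lemma13 (H : sgraph -> Prop)
  (noH : forall F : sgraph, H F -> ~ exists x y : F, false_twins x y) :
  bounded_cw (fun G => free H G /\ atom G) <-> bounded_cw (free H).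
Proof.
split=> -[c bc]; last by exists c => G [Gfree _]; exact: bc.
(* The 1 covers graphs with at most one vertex, to which [atom_doubled] does not apply. *)
exists (maxn c 1) => G Gfree; apply/cw_leP.
have [n] := ubnP #|G|; elim: n G Gfree => // n IH G Gfree ltGn.
have [conn|] := boolP [forall x : G, forall y : G, connect (@edge G) x y].
  have {}conn (x y : G) : connect (@edge G) x y by move: conn => /forallP/(_ x)/forallP.
  have [G1|G1] := leqP #|G| 1.
    apply: constructible_embeds (embeds_refl G) (constructible_card G).
    exact: leq_trans G1 (leq_maxr _ _).
  apply: constructible_embeds (leq_maxl _ _) (embeds_doubled G) _.
  apply/cw_leP/bc; split; [exact: free_doubled | exact: atom_doubled].
move=> /forallPn[x /forallPn[y xy]].
(* The component of [x]: it misses [y] and its complement misses [x], so both sides are smaller than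
   [G]. *)
pose A := [set z | connect (@edge G) x z].
have small (S : {set G}) (z : G) : z \notin S ->
    constructible (maxn c 1) (induced S).
  move=> zS; apply: IH; first exact: free_embeds (induced_embeds S) Gfree.
  rewrite card_sig -ltnS; apply: leq_trans ltGn; rewrite ltnS.
  by apply: proper_card; apply/properP; split; [exact/subsetP | exists z].
apply: (constructible_split (A := A)).
- move=> a b; rewrite !inE => xa; apply: contra => ab.
  exact: connect_trans xa (connect1 ab).
- by apply: (small _ y); rewrite inE.
- by apply: (small _ x); rewrite !inE connect0.
Qed.
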